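(* Let $R$ be a finite commutative Frobenius ring of characteristic $2$ and let $p$ be a prime. For $i\in\{0,1,2\}$ let $a_i,b_i,c_i\in R$, let $Q_i=Q_p(a_i,b_i,c_i)$, and let $A_i$ be a $p\times p$ circulant matrix over $R$. Let $\mathcal{C}$ be the linear code of length $6p$ over $R$ generated by the rows of $$M=\left(\begin{array}{ccc|ccc} Q_0&Q_1&Q_2&A_0&A_1&A_2\\ Q_2&Q_0&Q_1&A_2&A_0&A_1\\ Q_1&Q_2&Q_0&A_1&A_2&A_0\end{array}\right).$$ If $\mathcal{C}$ is self-dual, then $$\left(\sum_{i=0}^2Q_i\right)B+\left(\sum_{i=0}^2Q_i\right)^TB'=I_p$$ for some $p\times p$ matrices $B$ and $B'$ over $R$.
   Context: For $a,b,c\in R$ and a prime $p$, $Q_p(a,b,c)$ is the $p\times p$ circulant matrix (each row is the right cyclic shift by one position of the row above it) whose first row $(r_0,r_1,\dots,r_{p-1})$ is given by $r_0=a$; $r_i=b$ if $i\neq 0$ is a quadratic residue modulo $p$; $r_i=c$ if $i$ is a quadratic non-residue modulo $p$. $I_p$ is the $p\times p$ identity matrix. A code of length $n$ over $R$ is an $R$-submodule of $R^n$; its dual is $\mathcal{C}^\perp=\{x\in R^n : \sum_i x_iy_i=0 \text{ for all } y\in \mathcal{C}\}$ (Euclidean inner product). $\mathcal{C}$ is self-dual if $\mathcal{C}=\mathcal{C}^\perp$. *)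

(* Defs.v *)
From HB Require Import structures.
From mathcomp Require Import all_boot all_order all_algebra.
Set Implicit Arguments.
Unset Strict Implicit.
Unset Printing Implicit Defensive.
Import GRing.Theory.
Local Open Scope ring_scope.

Section FrobeniusRing.
Variable R : finComNzRingType.
Implicit Types I K : {set R}.

Definition ideal I : bool :=
  (0 \in I) && [forall a, forall x in I, forall y in I, a * x + y \in I].

Definition maximal_ideal I : bool := maxset (fun K => ideal K && (K != setT)) I.

Definition minimal_ideal I : bool :=
  minset (fun K => ideal K && (K != [set 0])) I.

Definition jacobson_radical : {set R} := \bigcap_(I | maximal_ideal I) I.

(* The sum of the minimal ideals, i.e. the least ideal containing them all. *)
Definition socle : {set R} :=
  \bigcap_(I | ideal I && [forall (K | minimal_ideal K), K \subset I]) I.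

(* A finite commutative ring R is Frobenius when R / J(R) and soc(R) are
   isomorphic as R-modules.  An isomorphism R / J(R) -> soc(R) is given here by
   its composite with the projection R -> R / J(R): an R-linear map with kernel
   J(R) and image soc(R). *)
Definition frobenius : Prop :=
  exists phi : {linear R^o -> R^o},
    (forall x, (phi x == 0) = (x \in jacobson_radical))
    /\ [set phi x | x : R] = socle.

End FrobeniusRing.

Section Codes.
Variables (R : finComNzRingType) (n : nat).
Implicit Types C : {set 'rV[R]_n}.

Definition row_code m (M : 'M[R]_(m, n)) : {set 'rV[R]_n} :=
  [set u *m M | u : 'rV[R]_m].

Definition dual C : {set 'rV[R]_n} :=
  [set x : 'rV[R]_n | [forall y in C, \sum_i x 0 i * y 0 i == 0]].

Definition self_dual C : Prop := C = dual C.

End Codes.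

Section Circulant.
Variable R : finComNzRingType.

(* Since ord_pred j = j - 1 mod n, the (i, j) entry is r_(j - i mod n): each row
   is the right cyclic shift of the row above it. *)
Definition circ_mx n (r : 'rV[R]_n) : 'M[R]_n :=
  \matrix_(i, j) r 0 (iter i (@ord_pred n) j).

Definition circulant n (A : 'M[R]_n) : Prop := exists r, A = circ_mx r.

Definition quad_residue (p k : nat) : bool :=
  [exists x : 'I_p, x ^ 2 == k %[mod p]]%N.

Definition Qmx p (a b c : R) : 'M[R]_p :=
  circ_mx (\row_(i < p)
    if i == 0%N :> nat then a else if quad_residue p i then b else c).

Definition block_circ3 p (X : 'I_3 -> 'M[R]_p) :
    'M[R]_(p + (p + p), p + (p + p)) :=
  col_mx         (row_mx (X 0) (row_mx (X 1) (X 2)))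
    (col_mx      (row_mx (X 2) (row_mx (X 0) (X 1)))
                 (row_mx (X 1) (row_mx (X 2) (X 0)))).

End Circulant.

(* Main.v *)
Require Import Defs.
From HB Require Import structures.
From mathcomp Require Import all_boot all_order all_algebra.
From mathcomp Require Import fingroup perm.
Set Implicit Arguments.
Unset Strict Implicit.
Unset Printing Implicit Defensive.
Import GRing.Theory.
Local Open Scope ring_scope.

(** Write [s] for the sum of the [Q i] and [t] for the sum of the [A i].
    Adding up the three block rows of a block-circulant matrix maps the generator
    matrix [M] to [(s s s | t t t)], and so carries facts about [M] over to the
    pair [(s, t)].  Two such facts come from self-duality.

    The rows of [M] are orthogonal, whence [s s^T + t t^T = 0].  Moreover [M] has
    a right inverse, whence [s u + t v = 1] for some [u], [v].  The latter is
    a counting argument: the kernel of [x |-> x M^T] is the dual of the code,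
    that is, the code itself, which has at most [|R|^(3p)] elements because [M]
    has [3p] rows; so the image has at least [|R|^(6p) / |R|^(3p)] elements and
    is the whole space of row vectors of length [3p].

    The rest is algebra with circulant matrices, which commute with each other
    and with their transposes.  Since
    [t^T = t^T (s u + t v) = s (t^T u - s^T v)], the matrix [t^T] is a right
    multiple of [s].  Reversing the order of the indices turns every circulant
    matrix into its transpose, so [s u + t v = 1] also yields
    [s^T u' + t^T v' = 1]; substituting the multiple of [s] for [t^T] gives the
    identity sought. *)

(** * Generator matrices of self-dual codes *)

Section SelfDualCodes.
Variable R : finComNzRingType.

Lemma mem_dual_row_code m n (M : 'M[R]_(m, n)) (x : 'rV[R]_n) :
  (x \in dual (row_code M)) = (x *m M^T == 0).
Proof.
have dotE (y : 'rV[R]_n) : \sum_i x 0 i * y 0 i = (x *m y^T) 0 0.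
  by rewrite mxE; apply: eq_bigr => i _; rewrite mxE.
rewrite inE; apply/forall_inP/eqP => [x_orth | xM0 y /imsetP[u _ ->]].
  apply/rowP=> j; rewrite [RHS]mxE.
  have Mj : row j M \in row_code M by apply/imsetP; exists (delta_mx 0 j); rewrite ?rowE.
  rewrite -(eqP (x_orth _ Mj)) mxE.
  by apply: eq_bigr => i _; rewrite !mxE.
by rewrite dotE trmx_mul mulmxA xM0 mul0mx mxE.
Qed.

Lemma self_dual_orthogonal m n (M : 'M[R]_(m, n)) :
  self_dual (row_code M) -> M *m M^T = 0.
Proof.
move=> sdM; apply/row_matrixP=> i; rewrite row_mul row0; apply/eqP.
by rewrite -mem_dual_row_code -sdM; apply/imsetP; exists (delta_mx 0 i); rewrite ?rowE.
Qed.

(** The half of Lagrange's theorem used below: a choice of preimages writes every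
    vector as the preimage of its image plus an element of the kernel. *)
Lemma card_mulmx_image_kernel m n (N : 'M[R]_(n, m)) :
  (#|{: 'rV[R]_n}| <=
     #|[set x *m N | x : 'rV[R]_n]| * #|[set x : 'rV[R]_n | x *m N == 0%R]|)%N.
Proof.
set im := [set x *m N | x : 'rV[R]_n]; set ker := [set x | _].
pose g w := odflt 0 [pick x : 'rV[R]_n | x *m N == w].
rewrite -cardsX -cardsT.
apply: leq_trans (leq_imset_card (fun wk => g wk.1 + wk.2) (setX im ker)).
apply/subset_leq_card/subsetP=> x _; apply/imsetP.
exists (x *m N, x - g (x *m N)); last by rewrite /= addrC subrK.
rewrite in_setX /= (imset_f (fun y => y *m N)) // inE mulmxBl subr_eq0 eq_sym /g.
by case: pickP => [y // | /(_ x)]; rewrite eqxx.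
Qed.

(** The image and the kernel of [x |-> x M^T] have sizes with product at least
    [|R|^(2m)]; the kernel is the code itself, of size at most [|R|^m], so the map
    is onto, and preimages of the unit vectors are the columns of [N]. *)
Lemma self_dual_right_inverse m (M : 'M[R]_(m, m + m)) :
  self_dual (row_code M) -> exists N, M *m N = 1%:M.
Proof.
move=> sdM.
have kerE : [set x | x *m M^T == 0] = row_code M.
  by rewrite [RHS]sdM; apply/setP=> x; rewrite mem_dual_row_code inE.
have codeM : (#|row_code M| <= #|R| ^ m)%N.
  by apply: leq_trans (leq_imset_card _ _) _; rewrite card_mx mul1n.
have R_gt0 : (0 < #|R| ^ m)%N by rewrite expn_gt0; apply/orP; left; apply/card_gt0P; exists 0.
have imT : [set x *m M^T | x : 'rV[R]_(m + m)] = setT.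
  apply/eqP; rewrite eqEcard subsetT cardsT card_mx mul1n -(leq_pmul2r R_gt0) -expnD.
  have := card_mulmx_image_kernel M^T; rewrite kerE card_mx mul1n.
  by move/leq_trans; apply; rewrite leq_mul2l codeM orbT.
have preim i : exists x : 'rV[R]_(m + m), x *m M^T == row i 1%:M.
  have : row i (1%:M : 'M[R]_m) \in [set x *m M^T | x : 'rV[R]_(m + m)] by rewrite imT inE.
  by case/imsetP=> x _ ->; exists x.
pose N := \matrix_i xchoose (preim i).
exists N^T; apply: trmx_inj; rewrite trmx_mul trmxK trmx1.
by apply/row_matrixP=> i; rewrite row_mul rowK (eqP (xchooseP (preim i))).
Qed.

End SelfDualCodes.

(** * Circulant matrices *)

Section CirculantMatrices.
Variables (R : finComNzRingType) (n : nat).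
Implicit Types A B : 'M[R]_n.+1.

Lemma iter_ord_pred (i : nat) (j : 'I_n.+1) : iter i (@ord_pred _) j = j - inZp i.
Proof.
have inZpS k : inZp k.+1 = inZp k + inZp 1 :> 'I_n.+1.
  by apply: val_inj; rewrite /= modnDm addn1.
have ordSE (k : 'I_n.+1) : ordS k = k + inZp 1.
  by apply: val_inj; rewrite /= modnDmr addn1.
elim: i => [|i IHi] /=.
  by rewrite (_ : inZp 0 = 0) ?subr0 //; apply: val_inj; rewrite /= mod0n.
by rewrite IHi; apply: (canLR (@ordSK _)); rewrite ordSE inZpS opprD addrA subrK.
Qed.

(** Reading the indices in the group Z/(n+1), a circulant matrix depends only on
    the difference of column and row; products and transposes then become
    computations in that group. *)
Lemma circulantP A :
  circulant A <-> exists f : 'I_n.+1 -> R, forall i j, A i j = f (j - i).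
Proof.
split=> [[r ->] | [f fA]].
  by exists (r 0) => i j; rewrite mxE iter_ord_pred valZpK.
by exists (\row_k f k); apply/matrixP=> i j; rewrite fA !mxE iter_ord_pred valZpK.
Qed.

Lemma circulant_sum I (r : seq I) (A : I -> 'M[R]_n.+1) :
  (forall i, circulant (A i)) -> circulant (\sum_(i <- r) A i).
Proof.
move=> cA; elim/big_ind: _ => [|B C /circulantP[f fB] /circulantP[g gC] | //].
  by apply/circulantP; exists (fun _ => 0) => i j; rewrite mxE.
by apply/circulantP; exists (fun k => f k + g k) => i j; rewrite mxE fB gC.
Qed.

Lemma circulant_tr A : circulant A -> circulant A^T.
Proof.
case/circulantP=> f fA; apply/circulantP; exists (fun k => f (- k)) => i j.
by rewrite mxE fA opprB.
Qed.

Lemma circulant_comm A B : circulant A -> circulant B -> A *m B = B *m A.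
Proof.
case/circulantP=> f fA /circulantP[g gB]; apply/matrixP=> i k; rewrite !mxE.
(* The involution j |-> i + k - j exchanges the differences j - i and k - j. *)
rewrite (reindex_inj (inv_inj (subKr (i + k)))); apply: eq_bigr => j _.
rewrite !fA !gB mulrC; congr (g _ * f _).
  by rewrite opprB [i + k]addrC opprD addrCA addNKr.
by rewrite [i + k]addrC addrAC addrK.
Qed.

(** The permutation matrix of [i |-> - i] in Z/(n+1); conjugating by it negates
    [j - i], which for circulant matrices amounts to transposition. *)
Definition reversal_mx : 'M[R]_n.+1 := perm_mx (perm (@oppr_inj 'I_n.+1)).

Lemma reversal_mx_sqr : reversal_mx *m reversal_mx = 1%:M.
Proof.
rewrite -perm_mxM (_ : _ * _ = 1)%g ?perm_mx1 //.
by apply/permP=> i; rewrite permM !permE opprK.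
Qed.

Lemma reversal_mx_circulant A :
  circulant A -> reversal_mx *m A = A^T *m reversal_mx.
Proof.
case/circulantP=> f fA.
rewrite /reversal_mx; set q := perm _.
rewrite -row_permE -[in RHS](invgK q) -col_permE.
apply/matrixP=> i j; rewrite !mxE !fA; congr (f _).
have jE : j = - (q^-1%g j) by rewrite -[in LHS](permKV q j) permE.
by rewrite [in LHS]jE [q i]permE opprK addrC.
Qed.

(** Eliminating [t]: the norm identity makes [t^T] a right multiple of [s], and
    conjugating by the reversal turns [s u + t v = 1] into a relation between
    [s^T] and [t^T], in which that multiple can replace [t^T]. *)
Lemma circulant_unimodular_tr (s t u v : 'M[R]_n.+1) :
  circulant s -> circulant t ->
  s *m s^T + t *m t^T = 0 -> s *m u + t *m v = 1%:M ->
  exists B B', s *m B + s^T *m B' = 1%:M.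
Proof.
move=> cs ct norm0 uv1; have ctT := circulant_tr ct.
have ttT : t *m t^T = - (s *m s^T).
  by apply/eqP; rewrite -subr_eq0 opprK addrC norm0.
have tT_mul : t^T = s *m (t^T *m u - s^T *m v).
  rewrite mulmxBr !mulmxA (circulant_comm cs ctT) -mulNmx -ttT.
  by rewrite (circulant_comm ct ctT) -!mulmxA -mulmxDr uv1 mulmx1.
pose P := reversal_mx.
have uv1T : s^T *m (P *m u *m P) + t^T *m (P *m v *m P) = 1%:M.
  rewrite !mulmxA -!reversal_mx_circulant // -mulmxDl -!mulmxA -mulmxDr.
  by rewrite uv1 mulmx1 reversal_mx_sqr.
exists ((t^T *m u - s^T *m v) *m (P *m v *m P)), (P *m u *m P).
by rewrite mulmxA -tT_mul addrC.
Qed.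

End CirculantMatrices.

(** * Summing the blocks of a block-circulant matrix *)

Section BlockSums.
Variables (R : finComNzRingType) (p : nat).
Implicit Types X Y : 'I_3 -> 'M[R]_p.

(** Left multiplication by this matrix adds up the three block rows. *)
Definition block_ones : 'M[R]_(p, p + (p + p)) := row_mx 1%:M (row_mx 1%:M 1%:M).

Lemma sum_ord3 X : \sum_(i < 3) X i = X 0 + X 1 + X 2.
Proof.
rewrite !big_ord_recr big_ord0 /= add0r.
by congr (X _ + X _ + X _); apply: val_inj.
Qed.

(** Each block occurs once in each block column, and, for the transposed
    statement below, once in each block row. *)
Lemma block_ones_circ3 X :
  block_ones *m block_circ3 X = (\sum_(i < 3) X i) *m block_ones.
Proof.
rewrite sum_ord3 /block_ones /block_circ3 !mul_row_col !mul1mx !mul_mx_row !mulmx1.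
rewrite !add_row_mx; congr (row_mx _ (row_mx _ _)).
- by rewrite addrA addrAC.
- by rewrite addrCA addrA.
- by rewrite addrC [X 1 + _]addrC.
Qed.

Lemma block_ones_circ3_tr X :
  block_ones *m (block_circ3 X)^T = (\sum_(i < 3) X i)^T *m block_ones.
Proof.
apply: trmx_inj; rewrite !trmx_mul !trmxK sum_ord3 /block_ones /block_circ3.
rewrite !tr_row_mx trmx1 !mul_col_mx !mul_row_col !mulmx1 !mul1mx.
congr (col_mx _ (col_mx _ _)).
- by rewrite addrA.
- by rewrite addrC.
- by rewrite addrA addrC addrA.
Qed.

(** A right inverse of [block_ones]; it strips the factor [block_ones] that the
    two preceding lemmas leave on the right. *)
Definition first_block : 'M[R]_(p + (p + p), p) := col_mx 1%:M 0.

Lemma block_ones_first : block_ones *m first_block = 1%:M.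
Proof. by rewrite mul_row_col mulmx1 mulmx0 addr0. Qed.

Lemma block_circ3_norm_sum X Y :
  block_circ3 X *m (block_circ3 X)^T + block_circ3 Y *m (block_circ3 Y)^T = 0 ->
  (\sum_(i < 3) X i) *m (\sum_(i < 3) X i)^T
    + (\sum_(i < 3) Y i) *m (\sum_(i < 3) Y i)^T = 0.
Proof.
have normE Z : block_ones *m (block_circ3 Z *m (block_circ3 Z)^T) *m first_block
    = (\sum_(i < 3) Z i) *m (\sum_(i < 3) Z i)^T.
  rewrite mulmxA block_ones_circ3 -(mulmxA _ block_ones) block_ones_circ3_tr.
  by rewrite -!mulmxA block_ones_first mulmx1.
move/(congr1 (fun Z => block_ones *m Z *m first_block)).
by rewrite mulmx0 mul0mx mulmxDr mulmxDl !normE.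
Qed.

Lemma block_circ3_unimodular_sum X Y U V :
  block_circ3 X *m U + block_circ3 Y *m V = 1%:M ->
  exists u v, (\sum_(i < 3) X i) *m u + (\sum_(i < 3) Y i) *m v = 1%:M.
Proof.
move=> UV1; exists (block_ones *m U *m first_block), (block_ones *m V *m first_block).
rewrite !mulmxA -!block_ones_circ3 -mulmxDl -!(mulmxA block_ones) -mulmxDr UV1.
by rewrite mulmx1 block_ones_first.
Qed.

End BlockSums.

(** * Self-dual codes generated by two block-circulant matrices *)

Theorem theorem4p4 (R : finComNzRingType) (p : nat) (a b c : 'I_3 -> R)
    (A : 'I_3 -> 'M[R]_p) :
  frobenius R -> 2%N \in [pchar R] -> prime p ->
  (forall i, circulant (A i)) ->
  let Q := fun i => Qmx p (a i) (b i) (c i) in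
  self_dual (row_code (row_mx (block_circ3 Q) (block_circ3 A))) ->
  exists B B' : 'M[R]_p,
    (\sum_(i < 3) Q i) *m B + (\sum_(i < 3) Q i)^T *m B' = 1%:M.
Proof.
move=> _ _ p_prime; case: p p_prime A => [//|n] _ A cA Q sdC.
have cQ i : circulant (Q i) by eexists.
have norm0 := self_dual_orthogonal sdC.
have [N] := self_dual_right_inverse sdC.
rewrite -(vsubmxK N) mul_row_col => /block_circ3_unimodular_sum[u [v uv1]].
rewrite tr_row_mx mul_row_col in norm0.
have sum0 := block_circ3_norm_sum norm0.
by apply: circulant_unimodular_tr sum0 uv1; apply: circulant_sum.
Qed.
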